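(* Let $\mathsf{Mon}$ be the category of monoids and monoid homomorphisms. The full subcategory of $\mathsf{Mon}$ determined by the protomodular objects and the full subcategory of $\mathsf{Mon}$ determined by the Mal'tsev objects both coincide with the category of groups. In other words, for any monoid $M$ the following conditions are equivalent: (i) $M$ is a group; (ii) $M$ is a Mal'tsev object of $\mathsf{Mon}$, i.e., the category $\mathrm{Pt}_M(\mathsf{Mon})$ of points over $M$ is unital; (iii) $M$ is a protomodular object of $\mathsf{Mon}$, i.e., all points over $M$ in $\mathsf{Mon}$ are stably strong.
   Context: Let $\mathcal{C}$ be a finitely complete category. A pair of morphisms $(r\colon C\to A,\ s\colon B\to A)$ is jointly strongly epimorphic if every monomorphism $m\colon M\to A$ through which both $r$ and $s$ factor is an isomorphism. A point over $B$ is a pair $(f\colon A\to B,\ s\colon B\to A)$ with $fs=1_B$. $\mathrm{Pt}_B(\mathcal{C})$ is the category of points over $B$; a morphism $(f,s)\to(f',s')$ in it is a morphism $x\colon A\to A'$ with $f'x=f$ and $xs=s'$. Given a point $(f,s)$ over $B$ and $g\colon C\to B$, form the pullback $C\times_B A$ with projections $\pi_C,\pi_A$; the pullback of $(f,s)$ along $g$ is the point $(\pi_C,\langle 1_C,sg\rangle)$ over $C$. The point $(f,s)$ is strong if for every $g\colon C\to B$ the pair $(\pi_A\colon C\times_BA\to A,\ s\colon B\to A)$ is jointly strongly epimorphic. It is stably strong if its pullback along every morphism with codomain $B$ is a strong point. A pointed finitely complete category is unital if for all objects $X,Y$ the point $(\pi_X\colon X\times Y\to X,\ \langle 1_X,0\rangle)$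 is strong, equivalently the pair $(\langle 1_X,0\rangle,\langle 0,1_Y\rangle)$ is jointly strongly epimorphic. Thus $\mathrm{Pt}_Y(\mathcal{C})$ is unital iff for every two points $(f\colon A\to Y,s)$ and $(g\colon C\to Y,t)$ over $Y$ the morphisms $\langle 1_A,tf\rangle\colon A\to A\times_YC$ and $\langle sg,1_C\rangle\colon C\to A\times_YC$ are jointly strongly epimorphic in $\mathcal{C}$. An object $Y$ is a Mal'tsev object if $\mathrm{Pt}_Y(\mathcal{C})$ is unital, and a protomodular object if every point over $Y$ is stably strong. *)

(* Defs.v *)
From HB Require Import structures.
From mathcomp Require Import all_boot.
From mathcomp Require Import monoid.
From mathcomp Require Import boolp.

Set Implicit Arguments.
Unset Strict Implicit.
Unset Printing Implicit Defensive.

Declare Scope cat_scope.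
Local Open Scope cat_scope.

Record category := Category {
  obj :> Type;
  hom : obj -> obj -> Type;
  idm : forall A, hom A A;
  comp : forall A B D, hom B D -> hom A B -> hom A D;
  compA : forall A B D E (h : hom D E) (g : hom B D) (f : hom A B),
    comp h (comp g f) = comp (comp h g) f;
  comp1m : forall A B (f : hom A B), comp (idm B) f = f;
  compm1 : forall A B (f : hom A B), comp f (idm A) = f }.

Arguments idm {c} A.
Notation "g '∘' f" := (comp g f) (at level 40, left associativity) : cat_scope.

Definition monic (C : category) (A B : C) (m : hom A B) : Prop :=
  forall (X : C) (u v : hom X A), m ∘ u = m ∘ v -> u = v.

Definition is_iso (C : category) (A B : C) (m : hom A B) : Prop :=
  exists n : hom B A, n ∘ m = idm A /\ m ∘ n = idm B.

Definition jointly_strongly_epic (C : category) (X Y A : C)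
    (r : hom X A) (s : hom Y A) : Prop :=
  forall (M : C) (m : hom M A), monic m ->
    (exists r' : hom X M, r = m ∘ r') -> (exists s' : hom Y M, s = m ∘ s') ->
    is_iso m.

Record pullback (C : category) (A B D : C) (f : hom A D) (g : hom B D) :=
  Pullback {
    pb_obj : C;
    pb_fst : hom pb_obj A;
    pb_snd : hom pb_obj B;
    pb_comm : f ∘ pb_fst = g ∘ pb_snd;
    pb_pair : forall (X : C) (u : hom X A) (v : hom X B),
      f ∘ u = g ∘ v -> hom X pb_obj;
    pb_fstK : forall (X : C) (u : hom X A) (v : hom X B) (e : f ∘ u = g ∘ v),
      pb_fst ∘ pb_pair e = u;
    pb_sndK : forall (X : C) (u : hom X A) (v : hom X B) (e : f ∘ u = g ∘ v),
      pb_snd ∘ pb_pair e = v;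
    pb_ext : forall (X : C) (h k : hom X pb_obj),
      pb_fst ∘ h = pb_fst ∘ k -> pb_snd ∘ h = pb_snd ∘ k -> h = k }.

(* Finite completeness is given by a terminal object and chosen pullbacks; the
   notions below do not depend on the choice, up to isomorphism. *)
Record lexCategory := LexCategory {
  lex_cat :> category;
  term : lex_cat;
  to_term : forall A : lex_cat, hom A term;
  to_term_uniq : forall (A : lex_cat) (u v : hom A term), u = v;
  pb : forall (A B D : lex_cat) (f : hom A D) (g : hom B D), pullback f g }.

Arguments term {l}.

(* Pointedness: the terminal object is also initial. *)
Record pointedLexCategory := PointedLexCategory {
  pointed_lex :> lexCategory;
  from_zero : forall A : pointed_lex, hom term A;
  from_zero_uniq : forall (A : pointed_lex) (u v : hom term A), u = v }.

Definition zero_hom (C : pointedLexCategory) (A B : C) : hom A B :=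
  from_zero B ∘ to_term A.

Record point (C : category) (B : C) := Point {
  pt_dom : C;
  pt_map : hom pt_dom B;
  pt_sec : hom B pt_dom;
  pt_split : pt_map ∘ pt_sec = idm B }.

Lemma pullback_point_eq (C : lexCategory) (B : C) (p : point B)
    (X : C) (g : hom X B) :
  g ∘ idm X = pt_map p ∘ (pt_sec p ∘ g).
Proof. by rewrite compm1 compA pt_split comp1m. Qed.

Definition pullback_point (C : lexCategory) (B : C) (p : point B)
    (X : C) (g : hom X B) : point X :=
  Point (pb_fstK (pb g (pt_map p)) (pullback_point_eq p g)).

Definition strong_point (C : lexCategory) (B : C) (p : point B) : Prop :=
  forall (X : C) (g : hom X B),
    jointly_strongly_epic (pb_snd (pb g (pt_map p))) (pt_sec p).

Definition stably_strong_point (C : lexCategory) (B : C) (p : point B) : Prop :=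
  forall (X : C) (g : hom X B), strong_point (pullback_point p g).

(* Binary products are pullbacks over the terminal object. *)
Definition prod_pb (C : lexCategory) (X Y : C) : pullback (to_term X) (to_term Y) :=
  pb (to_term X) (to_term Y).

Definition prod_pair (C : lexCategory) (X Y Z : C) (u : hom Z X) (v : hom Z Y) :
    hom Z (pb_obj (prod_pb X Y)) :=
  pb_pair (prod_pb X Y) (to_term_uniq (to_term X ∘ u) (to_term Y ∘ v)).

Lemma prod_pair_fst (C : lexCategory) (X Y Z : C) (u : hom Z X) (v : hom Z Y) :
  pb_fst (prod_pb X Y) ∘ prod_pair u v = u.
Proof. exact: pb_fstK. Qed.

Definition prod_point (C : pointedLexCategory) (X Y : C) : point X :=
  Point (prod_pair_fst (idm X) (zero_hom X Y)).

Definition unital (C : pointedLexCategory) : Prop :=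
  forall X Y : C, strong_point (prod_point X Y).

Section PointCategory.
Variables (C : lexCategory) (B : C).
Implicit Types p q r : point B.

Record point_hom p q := PointHom {
  ph_hom :> hom (pt_dom p) (pt_dom q);
  ph_map : pt_map q ∘ ph_hom = pt_map p;
  ph_sec : ph_hom ∘ pt_sec p = pt_sec q }.

Lemma point_hom_ext p q (x y : point_hom p q) : ph_hom x = ph_hom y -> x = y.
Proof.
case: x y => [x xm xs] [y ym ys] /= exy; case: _ / exy in ym ys *.
by rewrite (Prop_irrelevance xm ym) (Prop_irrelevance xs ys).
Qed.

Definition point_id p : point_hom p p :=
  @PointHom p p (idm _) (compm1 _) (comp1m _).

Definition point_comp p q r (y : point_hom q r) (x : point_hom p q) :
  point_hom p r.
Proof.
by exists (ph_hom y ∘ ph_hom x); [rewrite compA !ph_map | rewrite -compA !ph_sec].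
Defined.

Definition point_category : category.
Proof.
exists (point B) point_hom point_id point_comp.
- by move=> *; apply: point_hom_ext; apply: compA.
- by move=> *; apply: point_hom_ext; apply: comp1m.
- by move=> *; apply: point_hom_ext; apply: compm1.
Defined.

Definition point_zero : point B := Point (comp1m (idm B)).

Definition point_to_zero p : point_hom p point_zero :=
  @PointHom p point_zero (pt_map p) (comp1m _) (pt_split p).

Definition point_from_zero p : point_hom point_zero p :=
  @PointHom point_zero p (pt_sec p) (pt_split p) (compm1 _).

Lemma point_to_zero_uniq p (u v : point_hom p point_zero) : u = v.
Proof.
by apply: point_hom_ext; rewrite -[LHS]comp1m -[RHS]comp1m !(@ph_map p point_zero).
Qed.

Lemma point_from_zero_uniq p (u v : point_hom point_zero p) : u = v.
Proof.
by apply: point_hom_ext; rewrite -[LHS]compm1 -[RHS]compm1 !(@ph_sec point_zero p).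
Qed.

Section PointPullback.
Variables (p q r : point B) (f : point_hom p r) (g : point_hom q r).
Let P := pb (ph_hom f) (ph_hom g).

Lemma point_pb_sec_eq : ph_hom f ∘ pt_sec p = ph_hom g ∘ pt_sec q.
Proof. by rewrite !ph_sec. Qed.

Lemma point_pb_split :
  pt_map p ∘ pb_fst P ∘ pb_pair P point_pb_sec_eq = idm B.
Proof. by rewrite -compA pb_fstK pt_split. Qed.

Definition point_pb_obj : point B := Point point_pb_split.

Definition point_pb_fst : point_hom point_pb_obj p :=
  @PointHom point_pb_obj p (pb_fst P) erefl (pb_fstK _ _).

Lemma point_pb_snd_map : pt_map q ∘ pb_snd P = pt_map p ∘ pb_fst P.
Proof. by rewrite -(ph_map f) -(ph_map g) -!compA (pb_comm P). Qed.

Definition point_pb_snd : point_hom point_pb_obj q :=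
  @PointHom point_pb_obj q (pb_snd P) point_pb_snd_map (pb_sndK _ _).

Section Pair.
Variables (x : point B) (u : point_hom x p) (v : point_hom x q).
Hypothesis e : point_comp f u = point_comp g v.

Lemma point_pb_pair_eq : ph_hom f ∘ ph_hom u = ph_hom g ∘ ph_hom v.
Proof. exact: (congr1 (@ph_hom x r) e). Qed.

Definition point_pb_pair : point_hom x point_pb_obj.
Proof.
exists (pb_pair P point_pb_pair_eq).
- by rewrite -compA pb_fstK ph_map.
- by apply: (pb_ext (p := P)); rewrite compA ?pb_fstK ?pb_sndK ph_sec.
Defined.
End Pair.

Definition point_pb : @pullback point_category p q r f g.
Proof.
exists point_pb_obj point_pb_fst point_pb_snd point_pb_pair.
- by apply: point_hom_ext; apply: (pb_comm P).
- by move=> *; apply: point_hom_ext; apply: pb_fstK.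
- by move=> *; apply: point_hom_ext; apply: pb_sndK.
- move=> X h k e1 e2; apply: point_hom_ext; apply: (pb_ext (p := P)).
  + exact: (congr1 (@ph_hom _ _) e1).
  + exact: (congr1 (@ph_hom _ _) e2).
Defined.

End PointPullback.

Definition point_lexCategory : lexCategory :=
  @LexCategory point_category point_zero point_to_zero point_to_zero_uniq point_pb.

Definition Pt : pointedLexCategory :=
  @PointedLexCategory point_lexCategory point_from_zero point_from_zero_uniq.

End PointCategory.

Definition maltsev_object (C : lexCategory) (Y : C) : Prop := unital (Pt Y).

Definition protomodular_object (C : lexCategory) (Y : C) : Prop :=
  forall p : point Y, stably_strong_point p.

Definition full_subcategory (C : category) (P : C -> Prop) : category.
Proof.
exists {A : C | P A} (fun A B => hom (sval A) (sval B)) (fun A => idm (sval A))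
  (fun A B D g f => g ∘ f).
- by move=> *; apply: compA.
- by move=> *; apply: comp1m.
- by move=> *; apply: compm1.
Defined.

Notation monoid_hom := UMagmaMorphism.type.

Lemma monoid_hom_ext (A B : monoidType) (f g : monoid_hom A B) : f =1 g -> f = g.
Proof.
case: f g => [f [[a] [b]]] [g [[c] [d]]] /= /funext efg.
case: _ / efg in c d *.
by rewrite (Prop_irrelevance a c) (Prop_irrelevance b d).
Qed.

Definition mon_category : category.
Proof.
exists monoidType (fun A B : monoidType => monoid_hom A B)
  (fun A : monoidType => (idfun : A -> A) : monoid_hom A A)
  (fun (A B D : monoidType) (g : monoid_hom B D) (f : monoid_hom A B) =>
     (g \o f : A -> D) : monoid_hom A D).
- by move=> *; apply: monoid_hom_ext.
- by move=> *; apply: monoid_hom_ext.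
- by move=> *; apply: monoid_hom_ext.
Defined.

Section MonTerminal.

Definition mon_one : Type := unit.
HB.instance Definition _ := Choice.on mon_one.

Let one_mul (x y : mon_one) : mon_one := tt.
Let one_mulA : associative one_mul. Proof. by []. Qed.
Let one_mul1 : left_id (tt : mon_one) one_mul. Proof. by case. Qed.
Let one_mulr1 : right_id (tt : mon_one) one_mul. Proof. by case. Qed.

HB.instance Definition _ := isMonoid.Build mon_one one_mulA one_mul1 one_mulr1.

End MonTerminal.

Definition mon_to_one (A : monoidType) : monoid_hom A mon_one := @one_fun A mon_one.

Lemma mon_to_one_uniq (A : monoidType) (u v : monoid_hom A mon_one) : u = v.
Proof. by apply: monoid_hom_ext => x; case: (u x) (v x) => -[]. Qed.

Section MonPullback.
Variables (A B D : monoidType) (f : monoid_hom A D) (g : monoid_hom B D).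
Local Open Scope group_scope.

Definition mon_pb_pred : pred (A * B) := fun x => f x.1 == g x.2.

Record mon_pb := MonPb { mon_pb_val : A * B; _ : mon_pb_pred mon_pb_val }.

HB.instance Definition _ := [isSub for mon_pb_val].
HB.instance Definition _ := [Choice of mon_pb by <:].

Lemma mon_pb_closed : monoid_closed mon_pb_pred.
Proof.
split=> [|x y]; rewrite !unfold_in /mon_pb_pred /= ?gmulf1 //.
by move=> /eqP ex /eqP ey; rewrite !gmulfM ex ey.
Qed.

HB.instance Definition _ :=
  SubChoice_isSubMonoid.Build (A * B)%type mon_pb_pred mon_pb mon_pb_closed.

Definition mon_pb_fst : monoid_hom mon_pb A := fst \o (val : mon_pb -> A * B).
Definition mon_pb_snd : monoid_hom mon_pb B := snd \o (val : mon_pb -> A * B).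

Section Pair.
Variables (X : monoidType) (u : monoid_hom X A) (v : monoid_hom X B).
Hypothesis e : f \o u =1 g \o v.

Definition mon_pb_pair_fun (x : X) : mon_pb :=
  MonPb (introT eqP (e x) : mon_pb_pred (u x, v x)).

Lemma mon_pb_pair_morph : monoid_morphism mon_pb_pair_fun.
Proof.
by split=> [|x y]; apply: val_inj; rewrite ?gmulfM ?gmulf1 //= ?gmulfM ?gmulf1.
Qed.

HB.instance Definition _ := isUMagmaMorphism.Build X mon_pb mon_pb_pair_fun
  mon_pb_pair_morph.

Definition mon_pb_pair : monoid_hom X mon_pb := mon_pb_pair_fun.
End Pair.

End MonPullback.

Definition mon_pullback (A B D : mon_category) (f : hom A D) (g : hom B D) :
  pullback f g.
Proof.
exists (mon_pb f g : monoidType) (mon_pb_fst f g) (mon_pb_snd f g)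
  (fun (X : monoidType) (u : monoid_hom X A) (v : monoid_hom X B) e =>
     mon_pb_pair (fun x : X => congr1 (fun h : monoid_hom X D => h x) e)).
- by apply: monoid_hom_ext => -[x] /= /eqP.
- by move=> *; apply: monoid_hom_ext.
- by move=> *; apply: monoid_hom_ext.
- move=> X h k e1 e2; apply: monoid_hom_ext => x; apply: val_inj.
  have /= := congr1 (fun h : monoid_hom X A => h x) e1.
  have /= := congr1 (fun h : monoid_hom X B => h x) e2.
  by case: (mon_pb_val _) (mon_pb_val _) => [a b] [c d] /= -> ->.
Defined.

Definition Mon : lexCategory :=
  @LexCategory mon_category mon_one mon_to_one mon_to_one_uniq mon_pullback.

Definition is_group (M : monoidType) : Prop :=
  exists inv : M -> M,
    left_inverse 1%g inv *%g /\ right_inverse 1%g inv *%g.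

Section GroupOf.
Variables (M : monoidType) (inv : M -> M).
Hypotheses (mulVg : left_inverse 1%g inv *%g) (mulgV : right_inverse 1%g inv *%g).

Definition group_of of left_inverse 1%g inv *%g & right_inverse 1%g inv *%g :
  Type := M.
Local Notation G := (group_of mulVg mulgV).
HB.instance Definition _ := Monoid.on G.
HB.instance Definition _ := hasInv.Build G inv.
HB.instance Definition _ := Monoid_isGroup.Build G mulVg mulgV.

End GroupOf.

Lemma is_groupP (M : monoidType) :
  is_group M <-> exists G : groupType, M = G :> monoidType.
Proof.
split=> [[inv [mulVg mulgV]] | [G ->]].
  by exists (group_of mulVg mulgV : groupType); case: M inv mulVg mulgV => T [].
by exists (@inv G); split; [apply: mulVg | apply: mulgV].
Qed.

(* Homomorphisms of groups are exactly the monoid homomorphisms between them,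
   so groups form a full subcategory of [Mon]. *)
Definition Grp : category := full_subcategory (is_group : Mon -> Prop).

(* Main.v *)
(* If M is a group, (x, a) = (1, a s(g x)^-1) (x, s(g x)) in the pullback of a
   point (f, s) along g, so every point over M is stably strong. A monic of points
   is monic in the base category, hence joint strong epimorphy of a pair in Pt_M
   can be tested there; as the product projection p × q -> p of Pt_M is the
   pullback of q along p, protomodular objects are Mal'tsev. Finally let M be a
   Mal'tsev monoid, m in M, and let A be the free product of M with the free
   monoid on x, retracted onto M by x |-> m. Then (x, x) is a product of elements
   (a, s f a) and (s f c, c) of A ×_M A. Its two letters x come from two distinct
   factors; comparing the words in both components, what stands between these
   letters is a two-sided inverse of m. Remembering only the value in M of words
   with at least two letters x avoids normal forms in the free product. *)
Require Import Defs.
From HB Require Import structures.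
From mathcomp Require Import all_boot.
From mathcomp Require Import monoid.
From mathcomp Require Import boolp.

Set Implicit Arguments.
Unset Strict Implicit.
Unset Printing Implicit Defensive.

Local Open Scope cat_scope.

(** * Joint strong epimorphy in [Pt B] and in the base category *)

Section PointJointlyStronglyEpic.
Variables (C : lexCategory) (B : C).
Implicit Types p q r : point B.

(** The kernel pair of [m] in [Pt B] is carried by its kernel pair in [C]. *)
Lemma monic_of_point_monic p q (m : point_hom p q) :
  @monic (Pt B) p q m -> monic (ph_hom m).
Proof.
move=> mono_m X u v muv.
pose k : @pullback (point_category B) _ _ _ m m := point_pb m m.
have e : pb_fst k = pb_snd k by apply: mono_m; exact: pb_comm k.
have {}e : pb_fst (pb (ph_hom m) (ph_hom m)) = pb_snd (pb (ph_hom m) (ph_hom m)).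
  exact: (congr1 (@ph_hom _ _ _ _) e).
by rewrite -(pb_fstK (pb _ _) muv) e pb_sndK.
Qed.

Lemma point_is_iso p q (m : point_hom p q) :
  is_iso (ph_hom m) -> @is_iso (Pt B) p q m.
Proof.
case=> n [nm mn].
have nmap : pt_map p ∘ n = pt_map q by rewrite -(ph_map m) -Defs.compA mn compm1.
have nsec : n ∘ pt_sec q = pt_sec p by rewrite -(ph_sec m) Defs.compA nm comp1m.
by exists (PointHom nmap nsec); split; apply: point_hom_ext.
Qed.

Lemma point_jointly_strongly_epicE p q r (x : point_hom p r) (y : point_hom q r) :
  @jointly_strongly_epic (Pt B) p q r x y <->
  jointly_strongly_epic (ph_hom x) (ph_hom y).
Proof.
split=> [epi N m mono_m [x' ex] [y' ey] | epi n m mono_m [x' ex] [y' ey]].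
  (* [N] becomes a point, with the section of [p] carried along [x']. *)
  have nsplit : pt_map r ∘ m ∘ (x' ∘ pt_sec p) = idm B.
    by rewrite -Defs.compA (Defs.compA m) -ex ph_sec pt_split.
  pose n : point B := Point nsplit.
  have msec : m ∘ pt_sec n = pt_sec r by rewrite /= Defs.compA -ex ph_sec.
  pose mh : point_hom n r := @PointHom C B n r m erefl msec.
  have xmap : pt_map n ∘ x' = pt_map p by rewrite /= -Defs.compA -ex ph_map.
  have ymap : pt_map n ∘ y' = pt_map q by rewrite /= -Defs.compA -ey ph_map.
  have ysec : y' ∘ pt_sec q = pt_sec n.
    by apply: mono_m; rewrite Defs.compA -ey ph_sec msec.
  have [|||k [km mk]] := epi n mh.
  - by move=> z u v e; apply: point_hom_ext; apply: mono_m;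
      exact: (congr1 (@ph_hom _ _ _ _) e).
  - by exists (@PointHom C B p n x' xmap erefl);
      apply: point_hom_ext.
  - by exists (@PointHom C B q n y' ymap ysec); apply: point_hom_ext.
  exists (ph_hom k); split.
  - exact: (congr1 (@ph_hom _ _ _ _) km).
  - exact: (congr1 (@ph_hom _ _ _ _) mk).
apply: point_is_iso; apply: epi; first exact: monic_of_point_monic.
- by exists (ph_hom x'); rewrite ex.
- by exists (ph_hom y'); rewrite ey.
Qed.

(* The product projection [p × q -> p] in [Pt B] is the pullback of [q] along
   [pt_map p]. *)
Lemma prod_point_sec p q :
  ph_hom (pt_sec (prod_point (p : Pt B) q)) = pt_sec (pullback_point q (pt_map p)).
Proof.
by apply: (pb_ext (p := pb (pt_map p) (pt_map q)));
  rewrite ?(pb_fstK (pb _ _)) ?(pb_sndK (pb _ _)).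
Qed.

End PointJointlyStronglyEpic.

Lemma protomodular_maltsev (C : lexCategory) (Y : C) :
  protomodular_object Y -> maltsev_object Y.
Proof.
move=> protoY p q r g; apply/point_jointly_strongly_epicE.
rewrite prod_point_sec; exact: (protoY q _ (pt_map p) _ (ph_hom g)).
Qed.

Local Open Scope group_scope.

(** * Joint strong epimorphy in [Mon]; groups are protomodular *)

Lemma mon_monic_inj (A B : Mon) (m : hom A B) :
  monic m -> injective (m : monoid_hom A B).
Proof.
move=> mono_m x y exy; pose k := mon_pullback m m.
have e : pb_fst k = pb_snd k by apply: mono_m; exact: pb_comm k.
have xy : mon_pb_pred (m : monoid_hom A B) (m : monoid_hom A B) (x, y) by apply/eqP.
exact: (congr1 (fun h : monoid_hom _ A => h (MonPb xy)) e).
Qed.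

Section MonInverse.
Variables (A B : monoidType) (m : monoid_hom A B) (n : B -> A).
Hypotheses (mK : cancel m n) (nK : cancel n m).

Lemma mon_inverse_morph : monoid_morphism n.
Proof.
split=> [|x y]; first by rewrite -[RHS]mK gmulf1.
by rewrite -{1}(nK x) -{1}(nK y) -gmulfM mK.
Qed.

Let n' : B -> A := n.
HB.instance Definition _ := isUMagmaMorphism.Build B A n' mon_inverse_morph.

Lemma mon_cancel_is_iso : @is_iso Mon A B m.
Proof.
by exists (n' : monoid_hom B A); split; apply: monoid_hom_ext => x /=;
  rewrite /n' ?mK ?nK.
Qed.

End MonInverse.

(** The image of [m] contains all these products, so [m] is bijective. *)
Lemma mon_jointly_strongly_epic (X Y A : Mon) (r : hom X A) (s : hom Y A) :
  (forall a : A, exists x y,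
    a = (r : monoid_hom X A) x * (s : monoid_hom Y A) y) ->
  jointly_strongly_epic r s.
Proof.
move=> gen N m mono_m [r' er] [s' es].
have surj (a : A) : exists n : N, (m : monoid_hom N A) n = a.
  have [x [y ->]] := gen a; rewrite er es.
  exists ((r' : monoid_hom X N) x * (s' : monoid_hom Y N) y).
  exact: gmulfM.
have nK a : (m : monoid_hom N A) (sval (cid (surj a))) = a := svalP (cid (surj a)).
apply: (mon_cancel_is_iso (n := fun a => sval (cid (surj a)))) => // x.
exact: (mon_monic_inj mono_m).
Qed.

(* An element [(x, a)] of the pullback splits as [(1, k) * (x, s (g x))] with
   [k = a * s (g x)^-1] in the kernel of the point. *)
Lemma group_protomodular (M : Mon) : is_group M -> protomodular_object M.
Proof.
case=> inv [mulVg mulgV] p X g Z h.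
set f := pt_map p : monoid_hom (pt_dom p) M.
set s := pt_sec p : monoid_hom M (pt_dom p).
set g' := g : monoid_hom X M; set h' := h : monoid_hom Z X.
have sK b : f (s b) = b := congr1 (fun k : monoid_hom M M => k b) (pt_split p).
apply: mon_jointly_strongly_epic => -[[x a] xa].
have /= /eqP exa := xa.
set k := a * s (inv (g' x)).
have fk : f k = 1 by rewrite gmulfM sK -[f a]exa mulgV.
have pk : mon_pb_pred g' f (1, k) by rewrite /mon_pb_pred /= gmulf1 fk.
(* [K] lies over 1 in [X], so [(1, K)] is in the pullback along any [h]. *)
pose K := MonPb pk.
have pK : mon_pb_pred h' (mon_pb_fst g' f) (1, K).
  by rewrite /mon_pb_pred /= gmulf1.
exists (MonPb pK), x; apply: val_inj => /=.
rewrite [RHS](_ : _ = (1 * x, k * s (g' x))) //.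
by rewrite mul1g -mulgA -gmulfM mulVg gmulf1 mulg1.
Qed.

(* A truncation of the free product of [M] with the free monoid on one generator
   [x], retracted onto [M] by [x |-> m]. The summands stand for the words with
   zero, one ([u x v]) and at least two letters [x]; of the latter only the value
   in [M] is remembered. *)
Definition adjoin (M : monoidType) (m : M) : Type := (M + M * M + M)%type.

(** * Mal'tsev monoids are groups *)

Section Adjoin.
Variables (M : monoidType) (m : M).
Local Notation A := (adjoin m).

Definition adjoin_in (a : M) : A := inl (inl a).
Definition adjoin_word (u v : M) : A := inl (inr (u, v)).

Definition adjoin_eval (a : A) : M :=
  match a with
  | inl (inl u) => u
  | inl (inr (u, v)) => u * m * v
  | inr w => w
  end.

Definition adjoin_mul (a b : A) : A :=
  match a, b with
  | inl (inl u), inl (inl v) => adjoin_in (u * v)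
  | inl (inl u), inl (inr (v, w)) => adjoin_word (u * v) w
  | inl (inr (u, v)), inl (inl w) => adjoin_word u (v * w)
  | _, _ => inr (adjoin_eval a * adjoin_eval b)
  end.

Lemma adjoin_evalM a b : adjoin_eval (adjoin_mul a b) = adjoin_eval a * adjoin_eval b.
Proof. by case: a b => [[u|[u v]]|u] [[w|[w z]]|w] //=; rewrite !mulgA. Qed.

Lemma adjoin_mulA : associative adjoin_mul.
Proof.
by case=> [[u|[u v]]|u] [[w|[w z]]|w] [[t|[t r]]|t] //=; rewrite ?mulgA.
Qed.

Lemma adjoin_mul1 : left_id (adjoin_in 1) adjoin_mul.
Proof. by case=> [[u|[u v]]|u] /=; rewrite /adjoin_in ?mul1g. Qed.

Lemma adjoin_mulr1 : right_id (adjoin_in 1) adjoin_mul.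
Proof. by case=> [[u|[u v]]|u] /=; rewrite /adjoin_in ?mulg1. Qed.

HB.instance Definition _ := Choice.on A.
HB.instance Definition _ := isMonoid.Build A adjoin_mulA adjoin_mul1 adjoin_mulr1.

Lemma adjoin_eval_morph : @monoid_morphism A M adjoin_eval.
Proof. by split=> // a b; apply: adjoin_evalM. Qed.

HB.instance Definition _ := isUMagmaMorphism.Build A M adjoin_eval adjoin_eval_morph.

Lemma adjoin_in_morph : @monoid_morphism M A adjoin_in.
Proof. by []. Qed.

HB.instance Definition _ := isUMagmaMorphism.Build M A adjoin_in adjoin_in_morph.

Definition adjoin_map : @hom Mon (A : monoidType) M := (adjoin_eval : monoid_hom A M).
Definition adjoin_sec : @hom Mon M (A : monoidType) := (adjoin_in : monoid_hom M A).

Lemma adjoin_split : adjoin_map ∘ adjoin_sec = idm (M : Mon).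
Proof. exact: monoid_hom_ext. Qed.

Definition adjoin_point : point (M : Mon) := Point adjoin_split.

Local Notation AA := (mon_pb (adjoin_map : monoid_hom A M) (adjoin_map : monoid_hom A M)).

(* A product of pairs [(a, s (f a))] and [(s (f c), c)] of the form
   [(u x v, u' x v')] takes its two letters [x] from two factors of different
   kinds; the two disjuncts are the two possible orders of these factors, and
   [p] is what stands between the letters. *)
Definition adjoin_linked (z : AA) : Prop :=
  match val z with
  | (inl (inr (u, v)), inl (inr (u', v'))) =>
      exists p, v = p * m * v' /\ u' = u * m * p \/ u = u' * m * p /\ v' = p * m * v
  | _ => True
  end.

Definition adjoin_linkedb : pred AA := fun z => `[< adjoin_linked z >].

Lemma adjoin_linked_closed : monoid_closed adjoin_linkedb.
Proof.
split=> [|x y]; rewrite !unfold_in; first exact/asboolP.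
move=> /asboolP lx /asboolP ly; apply/asboolP; move: x y lx ly.
move=> [[a c] ac] [[b d] bd]; rewrite /adjoin_linked /=.
move: ac bd; rewrite /mon_pb_pred /= => /eqP ac /eqP bd.
case: a c ac => [[a|[a a']]|a] [[c|[c c']]|c] //= ac;
case: b d bd => [[b|[b b']]|b] [[d|[d d']]|d] //= bd lx ly; subst.
(* Both letters lie in one factor, whose [p] still serves. In the two middle cases they lie in
   different factors, and [p] multiplies the pieces between them. *)
- case: ly => p [[-> ->]|[-> ->]]; exists p; [left|right]; by rewrite !mulgA.
- by exists (c' * b); right; rewrite !mulgA.
- by exists (a' * d); left; rewrite !mulgA.
- case: lx => p [[-> ->]|[-> ->]]; exists p; [left|right]; by rewrite !mulgA.
Qed.

Record linked := Linked { linked_val : AA; _ : adjoin_linkedb linked_val }.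
HB.instance Definition _ := [isSub for linked_val].
HB.instance Definition _ := [Choice of linked by <:].
HB.instance Definition _ :=
  SubChoice_isSubMonoid.Build AA adjoin_linkedb linked adjoin_linked_closed.

Definition linked_incl : monoid_hom linked AA := (val : linked -> AA).

Section Lift.
Variables (X : monoidType) (u : monoid_hom X AA).
Hypothesis lu : forall x, adjoin_linked (u x).

Definition linked_lift_fun (x : X) : linked :=
  Linked (introT (asboolP _) (lu x) : adjoin_linkedb (u x)).

Lemma linked_lift_morph : monoid_morphism linked_lift_fun.
Proof. by split=> [|x y]; apply: val_inj; rewrite ?gmulfM ?gmulf1 //= ?gmulfM ?gmulf1. Qed.

HB.instance Definition _ :=
  isUMagmaMorphism.Build X linked linked_lift_fun linked_lift_morph.

Lemma linked_factor : exists v : @hom Mon X (linked : monoidType),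
  (u : @hom Mon X AA) = (linked_incl : @hom Mon linked AA) ∘ v.
Proof. by exists (linked_lift_fun : monoid_hom X linked); apply: monoid_hom_ext. Qed.

End Lift.

(** At the pair [(x, x)] the outer pieces [u], [v], [u'], [v'] are all 1, so either disjunct makes
    [p] an inverse of [m]. *)
Lemma adjoin_linked_generator : (forall z, adjoin_linked z) ->
  exists p, p * m = 1 /\ m * p = 1.
Proof.
move=> all_linked.
have ax : mon_pb_pred (adjoin_map : monoid_hom A M) (adjoin_map : monoid_hom A M)
  (adjoin_word 1 1, adjoin_word 1 1) by exact: eqxx.
have [p] := all_linked (MonPb ax).
by rewrite mul1g mulg1 => -[[e1 e2]|[e1 e2]]; exists p; split.
Qed.

Lemma maltsev_invertible : @maltsev_object Mon M -> exists p, p * m = 1 /\ m * p = 1.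
Proof.
move=> maltM; apply: adjoin_linked_generator.
pose p : Pt (M : Mon) := adjoin_point.
(* Pulling the projection back along the zero morphism gives its kernel, the pairs [(s b, c)]. *)
have /point_jointly_strongly_epicE := maltM p p _ (point_from_zero adjoin_point).
rewrite prod_point_sec => epi.
have [|||n [_ nK] z] := epi (linked : monoidType) linked_incl.
- move=> X u v uv; apply: monoid_hom_ext => x; apply: val_inj.
  exact: (congr1 (fun h : monoid_hom X AA => h x) uv).
(* Elements of either image have a component in [M], hence are linked vacuously. *)
- apply: linked_factor => -[[b [[a c] ac]] /= /eqP e].
  by rewrite /adjoin_linked /= -[a]e.
- by apply: linked_factor => a; rewrite /adjoin_linked /=; case: a => [[a|[a a']]|a].
have <- : linked_incl ((n : monoid_hom AA linked) z) = z.
  exact: (congr1 (fun h : monoid_hom AA AA => h z) nK).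
by case: (_ z) => w /= /asboolP.
Qed.

End Adjoin.

Lemma maltsev_group (M : Mon) : maltsev_object M -> is_group M.
Proof.
move=> maltM; have ex (m : M) := maltsev_invertible m maltM.
by exists (fun m => sval (cid (ex m))); split=> m; case: cid => p [].
Qed.

Theorem theorem7p7 :
  [/\ full_subcategory (fun M : Mon => protomodular_object M) = Grp,
      full_subcategory (fun M : Mon => maltsev_object M) = Grp &
      forall M : Mon,
        [<-> is_group M; maltsev_object M; protomodular_object M]].
Proof.
split.
- congr full_subcategory; apply/funext => M; apply/propext; split.
    by move=> /protomodular_maltsev /maltsev_group.
  exact: group_protomodular.
- congr full_subcategory; apply/funext => M; apply/propext; split.
    exact: maltsev_group.
  by move=> /group_protomodular /protomodular_maltsev.
- move=> M; split; first by move=> /group_protomodular /protomodular_maltsev.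
  split; first by move=> /maltsev_group /group_protomodular.
  by move=> /protomodular_maltsev /maltsev_group.
Qed.
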